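(* Let $t_0<t_1$, let $x_0,x_1\in\mathbb{R}$, let $H>0$, $g>0$ and $A,C_D,\rho_0\ge 0$ be constants, let $m:[t_0,t_1]\to(0,\infty)$ be continuously differentiable and let $c:[t_0,t_1]\to\mathbb{R}$ be continuous. Put $a=\frac{x_1-x_0}{t_1-t_0}$, $y(t)=a(t-t_0)+x_0$, $$\alpha(t)=\frac{AC_D\rho_0}{2m(t)}\exp\left(-\frac{y(t)}{H}\right),\qquad \beta(t)=g-c(t)\frac{\dot m(t)}{m(t)},$$ and let $B$ and $G_2=|\alpha|(t_1-t_0)^2$ be the numbers defined in the context. Then the boundary value problem $$-\ddot z(t)=\alpha(t)\,(\dot z(t)+a)^2\exp\left(-\frac{z(t)}{H}\right)+\beta(t),\quad t\in[t_0,t_1],\qquad z(t_0)=z(t_1)=0,$$ admits at least one solution provided the data are sufficiently small, more specifically if $$4(a+B)\,G_2<1.$$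
   Context: For a continuous function $u$ on $[t_0,t_1]$ write $|u|=\sup_{t\in[t_0,t_1]}|u(t)|$. Let $G$ be the (nonnegative, continuous, symmetric) Green function of $-\frac{d^2}{dt^2}$ on $[t_0,t_1]$ with homogeneous Dirichlet boundary conditions: $$G(t,s)=\begin{cases}\frac{(t-t_0)(t_1-s)}{t_1-t_0}, & t\le s,\\[2pt] \frac{(s-t_0)(t_1-t)}{t_1-t_0}, & t\ge s.\end{cases}$$ Define $$b(t)=\int_{t_0}^{t_1}G(t,s)\beta(s)\,ds,\qquad B=\max\{|b|,|\dot b|\}.$$ The constant $G_2$ is $$G_2=|\alpha|\max\{G_0,G_1\}=|\alpha|(t_1-t_0)^2,\qquad\text{with } G_0=\tfrac38(t_1-t_0)^2,\quad G_1=(t_1-t_0)^2.$$ Here $G_0$ and $G_1$ are the constants used in the bounds for $\sup_t\int_{t_0}^{t_1}|G(t,s)|\,ds$ and $\sup_t\int_{t_0}^{t_1}\left|\frac{\partial G}{\partial t}(t,s)\right|ds$, respectively. A solution is a function $z\in C^1([t_0,t_1],\mathbb{R})$ that is a fixed point of the equivalent integral equation $$z(t)=\int_{t_0}^{t_1}G(t,s)\,\alpha(s)(\dot z(s)+a)^2\exp\left(-\frac{z(s)}{H}\right)ds+b(t).$$ *)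

(* Defs.v *)
From Stdlib Require Import Reals.
From Coquelicot Require Import Coquelicot.
Local Open Scope R_scope.

(* Functions on [t0,t1] are represented by functions R -> R of which only the
   values on [t0,t1] matter. *)
Definition Icc (t0 t1 : R) (t : R) : Prop := t0 <= t <= t1.

(* f is C^1 on [t0,t1] with derivative df. [D_in] takes the limit of the
   difference quotient inside [t0,t1], so the derivative is one-sided at the
   endpoints; for t0 < t1 it determines df on [t0,t1]. *)
Definition C1_on (t0 t1 : R) (f df : R -> R) : Prop :=
  (forall t, Icc t0 t1 t -> D_in f df (Icc t0 t1) t) /\
  continuous_on (Icc t0 t1) df.

Definition supnorm (t0 t1 : R) (u : R -> R) : R :=
  real (Lub_Rbar (fun r => exists t, Icc t0 t1 t /\ r = Rabs (u t))).

Definition green (t0 t1 t s : R) : R :=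
  if Rle_dec t s then (t - t0) * (t1 - s) / (t1 - t0)
  else (s - t0) * (t1 - t) / (t1 - t0).

Definition bfun (t0 t1 : R) (beta : R -> R) (t : R) : R :=
  RInt (fun s => green t0 t1 t s * beta s) t0 t1.

(* [green] is affine in t on each side of [t0,t1], so for beta continuous on
   [t0,t1] the function [bfun t0 t1 beta] is differentiable on R and its
   derivatives at t0 and t1 are the one-sided ones. *)
Definition Bconst (t0 t1 : R) (beta : R -> R) : R :=
  Rmax (supnorm t0 t1 (bfun t0 t1 beta))
       (supnorm t0 t1 (Derive (bfun t0 t1 beta))).

(* Solutions of  - z'' = alpha (z' + a)^2 exp (- z / H) + beta,
   z(t0) = z(t1) = 0,  are the C^1 fixed points of the equivalent integral
   equation. *)
Definition bvp_solution (t0 t1 H a : R) (alpha beta z : R -> R) : Prop :=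
  exists dz : R -> R,
    C1_on t0 t1 z dz /\
    forall t, Icc t0 t1 t ->
      z t = RInt (fun s => green t0 t1 t s *
                    (alpha s * (dz s + a) ^ 2 * exp (- (z s / H)))) t0 t1
            + bfun t0 t1 beta t.

(* Main.v *)
(* In the coordinate x = z + y the problem reads x'' = - h, with
   h = k x'^2 exp (- x / H) + beta and k >= 0, and x takes the values x0, x1 at
   t0, t1. It is solved by shooting after a truncation: clamping x' to [- P, P]
   and x to [l, oo) makes h bounded and globally Lipschitz, so Picard iteration
   gives global solutions depending continuously on the initial velocity, and
   the intermediate value theorem hits x1. The truncation is inactive by a
   priori bounds that do not depend on P. Since k >= 0, x'' is bounded above,
   which bounds x below by some l. With psi x = exp (- K H exp (- x / H)) and
   K >= k, the derivative of x' psi x is at least - sup |beta|; as x' takes the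
   value a somewhere and psi x >= psi l > 0, this bounds |x'|. *)
Require Import Defs.
From Stdlib Require Import Reals Lra Lia.
From Coquelicot Require Import Coquelicot.
Local Open Scope R_scope.

(** * Sequences with geometrically decaying increments *)

(** Telescoping makes the sequence Cauchy, and the bound on [u (n + k) - u n], uniform in [k],
    survives the limit in [k]. *)
Lemma geometric_limit (u : nat -> R) (C : R)
  (hu : forall n, Rabs (u (S n) - u n) <= C * (/ 2) ^ n) :
  forall n, Rabs (u n - real (Lim_seq u)) <= 2 * C * (/ 2) ^ n.
Proof.
  assert (hC : 0 <= C).
  { generalize (hu 0%nat) (Rabs_pos (u 1%nat - u 0%nat)). simpl. lra. }
  assert (hpow : forall n, 0 < (/ 2) ^ n) by (intros n; apply pow_lt; lra).
  (* Keeping the subtracted term [(/ 2) ^ (n + k)] makes the bound strong enough for induction on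
     [k]. *)
  assert (hk : forall n k, Rabs (u (n + k)%nat - u n) <= 2 * C * ((/ 2) ^ n - (/ 2) ^ (n + k))).
  { intros n k. induction k as [|k IH].
    - rewrite Nat.add_0_r, Rminus_diag, Rabs_R0. lra.
    - rewrite Nat.add_succ_r.
      replace (u (S (n + k)) - u n) with ((u (S (n + k)) - u (n + k)%nat) + (u (n + k)%nat - u n)) by ring.
      eapply Rle_trans. apply Rabs_triang.
      generalize (hu (n + k)%nat). simpl. lra. }
  assert (hk' : forall n k, Rabs (u (n + k)%nat - u n) <= 2 * C * (/ 2) ^ n).
  { intros n k. eapply Rle_trans. apply hk.
    generalize (Rmult_le_pos _ _ hC (Rlt_le _ _ (hpow (n + k)%nat))). lra. }
  assert (hex : ex_finite_lim_seq u).
  { apply ex_lim_seq_cauchy_corr. intros eps.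
    assert (hgeom : is_lim_seq (fun n => 2 * C * (/ 2) ^ n) 0).
    { replace (Finite 0) with (Rbar_mult (2 * C) 0) by (simpl; f_equal; ring).
      apply is_lim_seq_scal_l, is_lim_seq_geom. rewrite Rabs_pos_eq; lra. }
    apply is_lim_seq_spec in hgeom.
    destruct (hgeom (pos_div_2 eps)) as [N hN].
    assert (hN' : forall n, (N <= n)%nat -> Rabs (u n - u N) < eps / 2).
    { intros n hn. replace n with (N + (n - N))%nat by lia.
      eapply Rle_lt_trans. apply hk'.
      eapply Rle_lt_trans. apply Rle_abs.
      generalize (hN N (Nat.le_refl N)). rewrite Rminus_0_r. simpl. lra. }
    exists N. intros n p hn hp.
    replace (u n - u p) with ((u n - u N) - (u p - u N)) by ring.
    eapply Rle_lt_trans. unfold Rminus at 1. apply Rabs_triang. rewrite Rabs_Ropp.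
    generalize (hN' n hn) (hN' p hp). lra. }
  intros n.
  apply Lim_seq_correct' in hex.
  apply (is_lim_seq_incr_n u n) in hex.
  assert (hd : is_lim_seq (fun k => Rabs (u n - u (k + n)%nat)) (Rabs (u n - real (Lim_seq u)))).
  { apply (is_lim_seq_abs _ (Finite (u n - real (Lim_seq u)))).
    apply is_lim_seq_minus' with (1 := is_lim_seq_const (u n)). exact hex. }
  refine (is_lim_seq_le _ _ _ _ _ hd (is_lim_seq_const (2 * C * (/ 2) ^ n))).
  intros k. rewrite Rabs_minus_sym, Nat.add_comm. apply hk'.
Qed.

(** * Integrals of continuous functions, weighted estimates, Lipschitz continuity *)

Lemma ex_RInt_continuous_all (u : R -> R) (a b : R) :
  (forall t, continuous u t) -> ex_RInt u a b.
Proof.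
  intros hu. apply (ex_RInt_continuous (V := R_CompleteNormedModule)). intros; apply hu.
Qed.

Lemma is_derive_primitive (u : R -> R) (t0 t : R) :
  (forall t, continuous u t) -> is_derive (fun t => RInt u t0 t) t (u t).
Proof.
  intros hu. apply (is_derive_RInt u _ t0).
  - apply filter_forall. intros s. apply (RInt_correct u). now apply ex_RInt_continuous_all.
  - apply hu.
Qed.

Lemma continuous_primitive (u : R -> R) (t0 t : R) :
  (forall t, continuous u t) -> continuous (fun t => RInt u t0 t) t.
Proof.
  intros hu. apply (ex_derive_continuous (fun t => RInt u t0 t)).
  eexists. now apply is_derive_primitive.
Qed.

Lemma RInt_diff (u w : R -> R) (a b : R) :
  (forall t, continuous u t) -> (forall t, continuous w t) ->
  RInt u a b - RInt w a b = RInt (fun t => u t - w t) a b.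
Proof.
  intros hu hw. symmetry. apply (RInt_minus u w); now apply ex_RInt_continuous_all.
Qed.

(** In the sup norm weighted by [exp (- l (s - t0))], integration from [t0] has norm at most
    [1 / l]. A large [l] thus makes the Picard operator a contraction on intervals of any length. *)
Lemma Rabs_RInt_exp_le (u : R -> R) (C l t0 t : R) :
  0 <= C -> 0 < l -> t0 <= t -> (forall s, continuous u s) ->
  (forall s, t0 <= s -> Rabs (u s) <= C * exp (l * (s - t0))) ->
  Rabs (RInt u t0 t) <= C / l * exp (l * (t - t0)).
Proof.
  intros hC hl ht hu hb.
  set (E := fun s => C * exp (l * (s - t0))).
  assert (hE : forall s, is_derive (fun s => C / l * exp (l * (s - t0))) s (E s)).
  { intros s. unfold E. auto_derive. trivial. unfold Rminus. field. lra. }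
  assert (hEc : forall s, continuous E s).
  { intros s. apply (ex_derive_continuous E). unfold E. auto_derive. trivial. }
  eapply Rle_trans. apply abs_RInt_le. trivial. now apply ex_RInt_continuous_all.
  apply Rle_trans with (RInt E t0 t).
  - apply RInt_le; trivial.
    + apply ex_RInt_continuous_all. intros s. apply (continuous_comp u Rabs). apply hu. apply continuous_Rabs.
    + now apply ex_RInt_continuous_all.
    + intros s hs. apply hb. lra.
  - erewrite (is_RInt_unique (V := R_CompleteNormedModule)).
    2: { apply (is_RInt_derive (fun s => C / l * exp (l * (s - t0)))); intros; [apply hE | apply hEc]. }
    unfold minus, plus, opp; simpl.
    rewrite Rminus_diag, Rmult_0_r, exp_0.
    assert (0 <= C / l) by (apply Rmult_le_pos; [trivial | left; now apply Rinv_0_lt_compat]).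
    lra.
Qed.

Lemma continuous_Lipschitz (u : R -> R) (M : R) (t : R) :
  (forall a b, a <= b -> Rabs (u b - u a) <= M * (b - a)) -> continuous u t.
Proof.
  intros hu.
  assert (hM : 0 <= M).
  { generalize (hu 0 1 Rle_0_1) (Rabs_pos (u 1 - u 0)). lra. }
  assert (hu' : forall a b, Rabs (u b - u a) <= M * Rabs (b - a)).
  { intros a b. destruct (Rle_dec a b).
    - rewrite (Rabs_pos_eq (b - a)) by lra. now apply hu.
    - rewrite Rabs_minus_sym, (Rabs_minus_sym b), (Rabs_pos_eq (a - b)) by lra. apply hu. lra. }
  apply continuity_pt_filterlim. intros eps heps.
  (* The denominator [M + 1] stays positive when [M = 0]. *)
  exists (eps / (M + 1)). split. apply Rdiv_lt_0_compat; lra.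
  intros s [_ hs]. simpl in *. unfold Rdist in *.
  apply Rle_lt_trans with (1 := hu' t s).
  apply Rle_lt_trans with ((M + 1) * Rabs (s - t)).
  - generalize (Rabs_pos (s - t)). nra.
  - apply (Rmult_lt_compat_l (M + 1)) in hs; [|lra].
    replace ((M + 1) * (eps / (M + 1))) with eps in hs by (field; lra). exact hs.
Qed.

(** * Picard iteration for [x'' = - f t x x'] *)

(** The unknown is the velocity [p] alone, with initial value [v]; the position is recovered as
    [x0 + RInt p t0 s]. This turns the second-order problem into a fixed-point equation for one
    scalar function. *)
Definition picard (f : R -> R -> R -> R) (t0 x0 v : R) (p : R -> R) (t : R) : R :=
  v - RInt (fun s => f s (x0 + RInt p t0 s) (p s)) t0 t.

(** Continuity of [f] is asked only along continuous curves, which is what the integrals require and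
    avoids topology on a product space. *)
Definition substitutive (f : R -> R -> R -> R) : Prop :=
  forall x p : R -> R, (forall t, continuous x t) -> (forall t, continuous p t) ->
  forall t, continuous (fun s => f s (x s) (p s)) t.

Definition Lipschitz2 (f : R -> R -> R -> R) (L : R) : Prop :=
  forall s x p x' p',
  Rabs (f s x p - f s x' p') <= L * (Rabs (x - x') + Rabs (p - p')).

Lemma continuous_picard_integrand f t0 x0 p :
  substitutive f -> (forall t, continuous p t) ->
  forall t, continuous (fun s => f s (x0 + RInt p t0 s) (p s)) t.
Proof.
  intros hf hp. apply (hf (fun s => x0 + RInt p t0 s) p); trivial.
  intros t. apply (continuous_plus (fun _ => x0)). apply continuous_const.
  now apply continuous_primitive.
Qed.

Lemma picard_Lipschitz f t0 x0 v p M a b :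
  substitutive f -> (forall t, continuous p t) ->
  (forall s x q, Rabs (f s x q) <= M) -> a <= b ->
  Rabs (picard f t0 x0 v p b - picard f t0 x0 v p a) <= M * (b - a).
Proof.
  intros hf hp hM hab. unfold picard.
  set (h := fun s => f s (x0 + RInt p t0 s) (p s)).
  assert (hh : forall t, continuous h t) by now apply continuous_picard_integrand.
  assert (hC : RInt h t0 a + RInt h a b = RInt h t0 b)
    by (apply (RInt_Chasles h); now apply ex_RInt_continuous_all).
  replace (v - RInt h t0 b - (v - RInt h t0 a)) with (- RInt h a b) by lra.
  rewrite Rabs_Ropp, Rmult_comm. apply abs_RInt_le_const; trivial.
  now apply ex_RInt_continuous_all. intros; apply hM.
Qed.

Lemma continuous_picard f t0 x0 v p M t :
  substitutive f -> (forall t, continuous p t) ->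
  (forall s x q, Rabs (f s x q) <= M) ->
  continuous (picard f t0 x0 v p) t.
Proof.
  intros hf hp hM. apply continuous_Lipschitz with M. intros; now apply picard_Lipschitz.
Qed.

(* The exponent 4 L + 1 of the weight makes the Picard operator a
   contraction of ratio 1/2. *)
Lemma picard_contraction f t0 x0 v w p q L D t :
  substitutive f -> 0 <= L -> Lipschitz2 f L ->
  (forall t, continuous p t) -> (forall t, continuous q t) -> 0 <= D ->
  (forall s, t0 <= s -> Rabs (p s - q s) <= D * exp ((4 * L + 1) * (s - t0))) ->
  t0 <= t ->
  Rabs (picard f t0 x0 v p t - picard f t0 x0 w q t)
    <= Rabs (v - w) + D / 2 * exp ((4 * L + 1) * (t - t0)).
Proof.
  intros hf hL hLip hp hq hD hpq ht. unfold picard.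
  set (hP := fun s => f s (x0 + RInt p t0 s) (p s)).
  set (hQ := fun s => f s (x0 + RInt q t0 s) (q s)).
  assert (cP : forall t, continuous hP t) by now apply continuous_picard_integrand.
  assert (cQ : forall t, continuous hQ t) by now apply continuous_picard_integrand.
  (* Velocities differ by at most [D] times the weight, and positions by at most [D / (4 L + 1)],
     hence [D], times the weight. The outer integration then gives the factor
     [2 L / (4 L + 1) <= 1 / 2]. *)
  assert (hdiff : forall s, t0 <= s ->
    Rabs (hP s - hQ s) <= 2 * L * D * exp ((4 * L + 1) * (s - t0))).
  { intros s hs. eapply Rle_trans. apply hLip.
    replace (x0 + RInt p t0 s - (x0 + RInt q t0 s)) with (RInt p t0 s - RInt q t0 s) by ring.
    rewrite RInt_diff by trivial.
    assert (h1 : Rabs (RInt (fun t => p t - q t) t0 s)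
                 <= D / (4 * L + 1) * exp ((4 * L + 1) * (s - t0))).
    { apply Rabs_RInt_exp_le; trivial. lra. intros r. now apply (continuous_minus p q). }
    assert (h2 : D / (4 * L + 1) <= D).
    { apply Rle_div_l; nra. }
    generalize (hpq s hs) (exp_pos ((4 * L + 1) * (s - t0))). intros h3 h4.
    assert (h5 := Rmult_le_compat_r _ _ _ (Rlt_le _ _ h4) h2).
    replace (2 * L * D * exp ((4 * L + 1) * (s - t0)))
      with (L * (D * exp ((4 * L + 1) * (s - t0)) + D * exp ((4 * L + 1) * (s - t0)))) by ring.
    apply Rmult_le_compat_l; lra. }
  replace (v - RInt hP t0 t - (w - RInt hQ t0 t))
    with ((v - w) + - (RInt hP t0 t - RInt hQ t0 t)) by ring.
  rewrite RInt_diff by trivial.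
  eapply Rle_trans. apply Rabs_triang. rewrite Rabs_Ropp.
  apply Rplus_le_compat_l.
  apply Rle_trans with (2 * L * D / (4 * L + 1) * exp ((4 * L + 1) * (t - t0))).
  - apply Rabs_RInt_exp_le; trivial. apply Rmult_le_pos; lra. lra.
    intros r. now apply (continuous_minus hP hQ).
  - apply Rmult_le_compat_r. left; apply exp_pos.
    apply Rle_div_l; nra.
Qed.

Fixpoint picard_iter (f : R -> R -> R -> R) (t0 x0 v : R) (n : nat) : R -> R :=
  match n with
  | O => fun _ => v
  | S n => picard f t0 x0 v (picard_iter f t0 x0 v n)
  end.

(* Truncation of the time at [t0] makes the iterates converge on all of R. *)
Definition picard_limit (f : R -> R -> R -> R) (t0 x0 v t : R) : R :=
  real (Lim_seq (fun n => picard_iter f t0 x0 v n (Rmax t0 t))).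

Lemma continuous_picard_iter f t0 x0 v M n :
  substitutive f -> (forall s x q, Rabs (f s x q) <= M) ->
  forall t, continuous (picard_iter f t0 x0 v n) t.
Proof.
  intros hf hM. induction n as [|n IH]; intros t; simpl.
  - apply continuous_const.
  - now apply continuous_picard with M.
Qed.

(** The first increment is at most [M] times the weight, and each application of the Picard operator
    halves this bound; [geometric_limit] at fixed [t] does the rest. *)
Lemma picard_limit_approx f t0 x0 v L M n t :
  substitutive f -> 0 <= L -> Lipschitz2 f L ->
  (forall s x q, Rabs (f s x q) <= M) -> t0 <= t ->
  Rabs (picard_iter f t0 x0 v n t - picard_limit f t0 x0 v t)
    <= 2 * M * (/ 2) ^ n * exp ((4 * L + 1) * (t - t0)).
Proof.
  intros hf hL hLip hM ht.
  assert (hM0 : 0 <= M) by (eapply Rle_trans; [apply Rabs_pos | apply (hM 0 0 0)]).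
  assert (hstep : forall n t, t0 <= t ->
    Rabs (picard_iter f t0 x0 v (S n) t - picard_iter f t0 x0 v n t)
      <= M * (/ 2) ^ n * exp ((4 * L + 1) * (t - t0))).
  { clear n t ht. intros n. induction n as [|n IH]; intros t ht.
    - assert (h := picard_Lipschitz f t0 x0 v (fun _ => v) M t0 t hf
        (fun t => continuous_const v t) hM ht).
      unfold picard in h at 2. rewrite RInt_point in h. unfold zero in h; simpl in h.
      rewrite Rminus_0_r in h. simpl.
      eapply Rle_trans. exact h. rewrite Rmult_1_r. apply Rmult_le_compat_l. trivial.
      (* Since [4 L + 1 >= 1], the weight dominates [t - t0]. *)
      generalize (exp_ineq1_le ((4 * L + 1) * (t - t0))). nra.
    - change (Rabs (picard f t0 x0 v (picard_iter f t0 x0 v (S n)) t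
        - picard f t0 x0 v (picard_iter f t0 x0 v n) t)
        <= M * (/ 2 * (/ 2) ^ n) * exp ((4 * L + 1) * (t - t0))).
      eapply Rle_trans. apply picard_contraction with (L := L) (D := M * (/ 2) ^ n); trivial.
      + apply (continuous_picard_iter f t0 x0 v M (S n)); trivial.
      + apply continuous_picard_iter with M; trivial.
      + apply Rmult_le_pos; trivial. apply pow_le; lra.
      + rewrite Rminus_diag, Rabs_R0. right. field. }
  unfold picard_limit. rewrite Rmax_right by trivial.
  replace (2 * M * (/ 2) ^ n * exp ((4 * L + 1) * (t - t0)))
    with (2 * (M * exp ((4 * L + 1) * (t - t0))) * (/ 2) ^ n) by ring.
  apply (geometric_limit (fun n => picard_iter f t0 x0 v n t)).
  intros k. eapply Rle_trans. now apply hstep. right; ring.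
Qed.

(** Used to carry estimates from the iterates to their limit: it suffices to prove them with an
    error [C (/ 2) ^ n] for every [n]. *)
Lemma Rle_of_geometric (a C : R) :
  (forall n, a <= C * (/ 2) ^ n) -> a <= 0.
Proof.
  intros h.
  assert (hgeom : is_lim_seq (fun n => C * (/ 2) ^ n) 0).
  { replace (Finite 0) with (Rbar_mult C 0) by (simpl; f_equal; ring).
    apply is_lim_seq_scal_l, is_lim_seq_geom. rewrite Rabs_pos_eq; lra. }
  exact (is_lim_seq_le _ _ _ _ h (is_lim_seq_const a) hgeom).
Qed.

(** All Picard images are [M]-Lipschitz, because [f] is bounded by [M], and this passes to the
    limit. *)
Lemma continuous_picard_limit f t0 x0 v L M t :
  substitutive f -> 0 <= L -> Lipschitz2 f L ->
  (forall s x q, Rabs (f s x q) <= M) ->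
  continuous (picard_limit f t0 x0 v) t.
Proof.
  intros hf hL hLip hM. apply continuous_Lipschitz with M. intros a b hab.
  assert (hM0 : 0 <= M) by (eapply Rle_trans; [apply Rabs_pos | apply (hM 0 0 0)]).
  set (P := picard_limit f t0 x0 v).
  (* The limit is constant to the left of [t0], so both points can be moved into the half-line where
     the approximation holds; this does not increase their distance. *)
  assert (hcl : forall s, P s = P (Rmax t0 s)).
  { intros s. unfold P, picard_limit. f_equal. f_equal.
    rewrite (Rmax_right t0 (Rmax t0 s)). reflexivity. apply Rmax_l. }
  rewrite (hcl a), (hcl b).
  set (a' := Rmax t0 a). set (b' := Rmax t0 b).
  assert (hab' : a' <= b' /\ b' - a' <= b - a).
  { unfold a', b', Rmax. destruct (Rle_dec t0 a), (Rle_dec t0 b); lra. }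
  assert (ha' : t0 <= a') by apply Rmax_l. assert (hb' : t0 <= b') by apply Rmax_l.
  apply Rle_trans with (M * (b' - a')); [|apply Rmult_le_compat_l; lra].
  apply Rminus_le.
  apply Rle_of_geometric with
    (M * (exp ((4 * L + 1) * (b' - t0)) + exp ((4 * L + 1) * (a' - t0)))).
  intros n. set (u := picard_iter f t0 x0 v).
  assert (h1 := picard_limit_approx f t0 x0 v L M (S n) a' hf hL hLip hM ha').
  assert (h2 := picard_limit_approx f t0 x0 v L M (S n) b' hf hL hLip hM hb').
  assert (h3 : Rabs (u (S n) b' - u (S n) a') <= M * (b' - a')).
  { apply picard_Lipschitz; trivial. now apply continuous_picard_iter with M. lra. }
  fold P in h1, h2. fold u in h1, h2. change ((/2) ^ S n) with (/2 * (/2)^n) in h1, h2.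
  apply Rabs_le_between in h1. apply Rabs_le_between in h2. apply Rabs_le_between in h3.
  assert (Rabs (P b' - P a') <= M * (b' - a') + M * (exp ((4 * L + 1) * (b' - t0)) + exp ((4 * L + 1) * (a' - t0))) * (/ 2) ^ n).
  { apply Rabs_le. lra. }
  lra.
Qed.

(** Both sides are within a multiple of [(/ 2) ^ n] of the iterate of index [S n]: the left by
    approximation, the right by contraction. *)
Lemma picard_limit_fixpoint f t0 x0 v L M t :
  substitutive f -> 0 <= L -> Lipschitz2 f L ->
  (forall s x q, Rabs (f s x q) <= M) -> t0 <= t ->
  picard_limit f t0 x0 v t = picard f t0 x0 v (picard_limit f t0 x0 v) t.
Proof.
  intros hf hL hLip hM ht.
  assert (hM0 : 0 <= M) by (eapply Rle_trans; [apply Rabs_pos | apply (hM 0 0 0)]).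
  set (P := picard_limit f t0 x0 v).
  apply Rminus_diag_uniq. apply Rabs_eq_0. apply Rle_antisym; [|apply Rabs_pos].
  apply Rle_of_geometric with (2 * M * exp ((4 * L + 1) * (t - t0))).
  intros n.
  assert (h1 := picard_limit_approx f t0 x0 v L M (S n) t hf hL hLip hM ht).
  assert (h2 : Rabs (picard f t0 x0 v (picard_iter f t0 x0 v n) t - picard f t0 x0 v P t)
    <= Rabs (v - v) + 2 * M * (/ 2) ^ n / 2 * exp ((4 * L + 1) * (t - t0))).
  { apply picard_contraction; trivial.
    - now apply continuous_picard_iter with M.
    - intros s. now apply continuous_picard_limit with L M.
    - apply Rmult_le_pos. lra. apply pow_le; lra.
    - intros s hs. now apply picard_limit_approx. }
  rewrite Rminus_diag, Rabs_R0 in h2.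
  change (picard_iter f t0 x0 v (S n)) with (picard f t0 x0 v (picard_iter f t0 x0 v n)) in h1.
  change ((/2) ^ S n) with (/2 * (/2)^n) in h1. fold P in h1.
  apply Rabs_le_between in h1. apply Rabs_le_between in h2. apply Rabs_le. lra.
Qed.

(** Each iterate satisfies the same bound. With [D = 2 |v - w|] the contraction estimate returns
    [|v - w|] plus [|v - w|] times the weight, and the weight is at least 1. *)
Lemma picard_limit_dependence f t0 x0 v w L M t :
  substitutive f -> 0 <= L -> Lipschitz2 f L ->
  (forall s x q, Rabs (f s x q) <= M) -> t0 <= t ->
  Rabs (picard_limit f t0 x0 v t - picard_limit f t0 x0 w t)
    <= 2 * Rabs (v - w) * exp ((4 * L + 1) * (t - t0)).
Proof.
  intros hf hL hLip hM ht.
  assert (hexp : forall s, t0 <= s -> 1 <= exp ((4 * L + 1) * (s - t0))).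
  { intros s hs. generalize (exp_ineq1_le ((4 * L + 1) * (s - t0))). nra. }
  assert (hn : forall n s, t0 <= s ->
    Rabs (picard_iter f t0 x0 v n s - picard_iter f t0 x0 w n s)
    <= 2 * Rabs (v - w) * exp ((4 * L + 1) * (s - t0))).
  { intros n. induction n as [|n IH]; intros s hs; generalize (hexp s hs) (Rabs_pos (v - w)).
    - simpl. nra.
    - intros h1 h2. simpl.
      eapply Rle_trans. apply picard_contraction with (L := L) (D := 2 * Rabs (v - w)); trivial.
      + now apply continuous_picard_iter with M.
      + now apply continuous_picard_iter with M.
      + lra.
      + nra. }
  apply Rminus_le.
  apply Rle_of_geometric with (4 * M * exp ((4 * L + 1) * (t - t0))). intros n.
  assert (h1 := picard_limit_approx f t0 x0 v L M n t hf hL hLip hM ht).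
  assert (h2 := picard_limit_approx f t0 x0 w L M n t hf hL hLip hM ht).
  assert (h3 := hn n t ht).
  apply Rabs_le_between in h1. apply Rabs_le_between in h2. apply Rabs_le_between in h3.
  assert (h : Rabs (picard_limit f t0 x0 v t - picard_limit f t0 x0 w t) <=
    2 * Rabs (v - w) * exp ((4 * L + 1) * (t - t0)) + 4 * M * exp ((4 * L + 1) * (t - t0)) * (/ 2) ^ n).
  { apply Rabs_le. lra. }
  lra.
Qed.

(** * Shooting for a bounded, globally Lipschitz force *)

Lemma exp_le_compat u v : u <= v -> exp u <= exp v.
Proof.
  intros [h | ->]. left; now apply exp_increasing. apply Rle_refl.
Qed.

(** The functions live on all of R, so derivatives at [t0] and [t1] are two-sided and [is_derive]
    applies everywhere. *)
Lemma shooting f t0 t1 x0 x1 L M :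
  t0 < t1 -> substitutive f -> 0 <= L -> Lipschitz2 f L ->
  (forall s x q, Rabs (f s x q) <= M) ->
  exists x p h : R -> R,
    (forall t, is_derive x t (p t)) /\ (forall t, is_derive p t (- h t)) /\
    (forall t, continuous h t) /\
    (forall t, t0 <= t -> h t = f t (x t) (p t)) /\ x t0 = x0 /\ x t1 = x1.
Proof.
  intros ht hf hL hLip hM.
  set (P := picard_limit f t0 x0).
  assert (cP : forall v t, continuous (P v) t)
    by (intros v t; now apply continuous_picard_limit with L M).
  assert (hP : forall v t, t0 <= t -> P v t = picard f t0 x0 v (P v) t)
    by (intros v t hs; now apply picard_limit_fixpoint with L M).
  assert (hv : exists v, RInt (P v) t0 t1 = x1 - x0).
  { set (T := t1 - t0).
    assert (hM0 : 0 <= M) by (eapply Rle_trans; [apply Rabs_pos | apply (hM 0 0 0)]).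
    (* The velocity leaves its initial value [v] by at most [M T], so the displacement differs from
       [v T] by at most [T (M T)]. *)
    assert (hdev : forall v, Rabs (RInt (P v) t0 t1 - v * T) <= T * (M * T)).
    { intros v.
      replace (v * T) with (RInt (fun _ => v) t0 t1)
        by (rewrite RInt_const; unfold scal; simpl; unfold mult; simpl; unfold T; ring).
      rewrite RInt_diff by (trivial; intros; apply continuous_const).
      apply abs_RInt_le_const. lra.
      - apply ex_RInt_continuous_all. intros t.
        apply (continuous_minus (P v)). apply cP. apply continuous_const.
      - intros t hs. rewrite hP by lra.
        (* The Picard image takes the value [v] at [t0], so its Lipschitz bound measures the
           deviation from [v]. *)
        replace v with (picard f t0 x0 v (P v) t0) at 3.
        2: { unfold picard. rewrite RInt_point. unfold zero; simpl. ring. }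
        eapply Rle_trans. apply picard_Lipschitz with (M := M); trivial. lra.
        apply Rmult_le_compat_l. trivial. unfold T. lra. }
    set (c := (x1 - x0) / T).
    assert (hc : x1 - x0 = c * T) by (unfold c, T; field; lra).
    (* With [c] the mean velocity, the deviation bound shows that initial velocities [c - M T] and
       [c + M T] undershoot and overshoot the target. *)
    destruct (IVT_gen (fun v => RInt (P v) t0 t1) (c - M * T) (c + M * T) (x1 - x0))
      as [v [_ hv]].
    - intros v. apply continuity_pt_filterlim.
      apply (continuous_Lipschitz (fun v => RInt (P v) t0 t1) (T * (2 * exp ((4 * L + 1) * T)))).
      intros a b hab. rewrite RInt_diff by trivial.
      replace (T * (2 * exp ((4 * L + 1) * T)) * (b - a))
        with ((t1 - t0) * (2 * (b - a) * exp ((4 * L + 1) * T))) by (unfold T; ring).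
      apply abs_RInt_le_const. lra.
      + apply ex_RInt_continuous_all. intros t. now apply (continuous_minus (P b) (P a)).
      + intros t hs. eapply Rle_trans. apply picard_limit_dependence with (L := L) (M := M); trivial. lra.
        rewrite (Rabs_pos_eq (b - a)) by lra.
        apply Rmult_le_compat_l. lra. apply exp_le_compat. unfold T. apply Rmult_le_compat_l; lra.
    - generalize (hdev (c - M * T)) (hdev (c + M * T)). intros h1 h2.
      apply Rabs_le_between in h1. apply Rabs_le_between in h2.
      split.
      + eapply Rle_trans. apply Rmin_l. rewrite hc. lra.
      + eapply Rle_trans; [|apply Rmax_r]. rewrite hc. lra.
    - now exists v. }
  destruct hv as [v hv].
  assert (cp : forall t, continuous (picard f t0 x0 v (P v)) t)
    by (intros t; now apply continuous_picard with M).
  assert (hx : forall t, t0 <= t -> RInt (picard f t0 x0 v (P v)) t0 t = RInt (P v) t0 t).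
  { intros t hs. apply RInt_ext. intros s [hs1 _].
    rewrite Rmin_left in hs1 by trivial. symmetry; apply hP. lra. }
  assert (ch := continuous_picard_integrand f t0 x0 (P v) hf (cP v)).
  (* The velocity is the Picard image of [P v] instead of [P v] itself: the two agree from [t0] on,
     but the image is differentiable on all of R. *)
  exists (fun t => x0 + RInt (picard f t0 x0 v (P v)) t0 t),
    (picard f t0 x0 v (P v)),
    (fun s => f s (x0 + RInt (P v) t0 s) (P v s)).
  split; [|split; [|split; [|split; [|split]]]].
  - intros t. apply (is_derive_ext (fun t => plus x0 (RInt (picard f t0 x0 v (P v)) t0 t))). reflexivity.
    replace (picard f t0 x0 v (P v) t) with (plus zero (picard f t0 x0 v (P v) t)) by apply plus_zero_l.
    apply (is_derive_plus (fun _ => x0)). apply (is_derive_const x0).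
    now apply is_derive_primitive.
  - intros t. unfold picard.
    set (h := fun s => f s (x0 + RInt (P v) t0 s) (P v s)) in *.
    assert (hd := is_derive_minus (fun _ => v) (fun t => RInt h t0 t) t zero (h t)
      (is_derive_const v t) (is_derive_primitive h t0 t ch)).
    unfold minus in hd; rewrite plus_zero_l in hd. exact hd.
  - exact ch.
  - intros t hs. cbv beta. rewrite hx, <- hP by trivial. reflexivity.
  - rewrite RInt_point. unfold zero; simpl; ring.
  - rewrite hx by lra. rewrite hv. ring.
Qed.

(** * The truncated force *)

(** It has two uses: cutting velocities to [[- P, P]], and retracting R onto [[t0, t1]] to extend
    the data by constants. *)
Definition clamp (l u t : R) : R := Rmax l (Rmin u t).

Lemma clamp_between l u t : l <= u -> l <= clamp l u t <= u.
Proof. unfold clamp, Rmax, Rmin. intros. destruct (Rle_dec u t); destruct Rle_dec; lra. Qed.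

Lemma clamp_id l u t : l <= t <= u -> clamp l u t = t.
Proof. intros. unfold clamp. rewrite Rmin_right by lra. apply Rmax_right. lra. Qed.

Lemma clamp_Lipschitz l u s t : Rabs (clamp l u s - clamp l u t) <= Rabs (s - t).
Proof.
  unfold clamp, Rmax, Rmin.
  destruct (Rle_dec u s), (Rle_dec u t); repeat destruct Rle_dec;
    unfold Rabs; repeat destruct Rcase_abs; lra.
Qed.

Lemma continuous_clamp l u t : continuous (clamp l u) t.
Proof.
  apply continuous_Lipschitz with 1. intros a b hab. rewrite Rmult_1_l.
  rewrite <- (Rabs_pos_eq (b - a)) by lra. apply clamp_Lipschitz.
Qed.

Lemma continuous_Rmax l t : continuous (Rmax l) t.
Proof.
  apply continuous_Lipschitz with 1. intros a b hab.
  unfold Rmax. repeat destruct Rle_dec; unfold Rabs; destruct Rcase_abs; lra.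
Qed.

(** For [v <= u], the tangent inequality [1 + r <= exp r] at [r = v - u] gives
    [exp u - exp v <= exp u (u - v)]. *)
Lemma exp_Lipschitz U u v : u <= U -> v <= U -> Rabs (exp u - exp v) <= exp U * Rabs (u - v).
Proof.
  assert (h : forall u v, v <= u -> u <= U -> Rabs (exp u - exp v) <= exp U * Rabs (u - v)).
  { clear u v. intros u v hvu hu.
    assert (hvu' := exp_le_compat _ _ hvu). rewrite !Rabs_pos_eq by lra.
    apply Rle_trans with (exp u * (u - v)).
    - replace v with (u + (v - u)) at 1 by ring. rewrite exp_plus.
      generalize (exp_ineq1_le (v - u)) (exp_pos u). nra.
    - apply Rmult_le_compat_r. lra. now apply exp_le_compat. }
  intros hu hv. destruct (Rle_dec v u).
  - now apply h.
  - rewrite Rabs_minus_sym, (Rabs_minus_sym u). apply h; lra.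
Qed.

(** The position is cut only from below, since [exp (- x / H)] is unbounded only as [x] tends to
    minus infinity. *)
Definition truncated_force (k beta : R -> R) (H l P t x q : R) : R :=
  k t * (clamp (- P) P q ^ 2 * exp (- (Rmax l x / H))) + beta t.

Lemma truncated_force_substitutive k beta H l P :
  0 < H -> (forall t, continuous k t) -> (forall t, continuous beta t) ->
  substitutive (truncated_force k beta H l P).
Proof.
  intros hH hk hb x p hx hp t. unfold truncated_force.
  apply (continuous_plus (fun s => k s * (clamp (- P) P (p s) ^ 2 * exp (- (Rmax l (x s) / H))))); trivial.
  apply (continuous_mult k); trivial.
  apply (continuous_mult (fun s => clamp (- P) P (p s) ^ 2)).
  - apply (continuous_comp (fun s => clamp (- P) P (p s)) (fun y => y ^ 2)).
    + apply (continuous_comp p); trivial. apply continuous_clamp.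
    + apply (ex_derive_continuous (fun y => y ^ 2)). auto_derive. trivial.
  - apply (continuous_comp (fun s => Rmax l (x s)) (fun y => exp (- (y / H)))).
    + apply (continuous_comp x); trivial. apply continuous_Rmax.
    + apply (ex_derive_continuous (fun y => exp (- (y / H)))). auto_derive. trivial.
Qed.

Lemma exp_Rmax_le H l x : 0 < H -> exp (- (Rmax l x / H)) <= exp (- (l / H)).
Proof.
  intros hH. apply exp_le_compat. apply Ropp_le_contravar.
  apply Rmult_le_compat_r. left; now apply Rinv_0_lt_compat. apply Rmax_l.
Qed.

Lemma clamp_sqr_le P q : 0 <= P -> 0 <= clamp (- P) P q ^ 2 <= P ^ 2.
Proof.
  intros hP. generalize (clamp_between (- P) P q). intros. nra.
Qed.

Lemma truncated_force_bound k beta H l P K b0 t x q :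
  0 < H -> 0 <= P -> (forall t, 0 <= k t <= K) -> (forall t, Rabs (beta t) <= b0) ->
  Rabs (truncated_force k beta H l P t x q) <= K * (P ^ 2 * exp (- (l / H))) + b0.
Proof.
  intros hH hP hk hb. unfold truncated_force.
  eapply Rle_trans. apply Rabs_triang. apply Rplus_le_compat; trivial.
  generalize (clamp_sqr_le P q hP) (exp_Rmax_le H l x hH) (exp_pos (- (Rmax l x / H))) (hk t).
  intros h1 h2 h3 h4.
  rewrite Rabs_pos_eq by (apply Rmult_le_pos; [lra | apply Rmult_le_pos; lra]).
  apply Rmult_le_compat; try lra. apply Rmult_le_pos; lra.
  apply Rmult_le_compat; lra.
Qed.

Lemma truncated_force_Lipschitz k beta H l P K :
  0 < H -> 0 <= P -> (forall t, 0 <= k t <= K) ->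
  Lipschitz2 (truncated_force k beta H l P)
    (K * (exp (- (l / H)) * (P ^ 2 / H + 2 * P))).
Proof.
  intros hH hP hk s x q x' q'. unfold truncated_force.
  set (E := exp (- (l / H))).
  assert (hE : 0 < E) by apply exp_pos.
  set (c := clamp (- P) P q). set (c' := clamp (- P) P q').
  set (e := exp (- (Rmax l x / H))). set (e' := exp (- (Rmax l x' / H))).
  assert (hc : Rabs (c - c') <= Rabs (q - q')) by apply clamp_Lipschitz.
  assert (hcb : - P <= c <= P) by (apply clamp_between; lra).
  assert (hcb' : - P <= c' <= P) by (apply clamp_between; lra).
  assert (he' : 0 <= e' <= E).
  { split. left; apply exp_pos. now apply exp_Rmax_le. }
  assert (hHi : 0 < / H) by now apply Rinv_0_lt_compat.
  assert (he : Rabs (e - e') <= E * (Rabs (x - x') / H)).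
  { assert (hm : forall z, - (Rmax l z / H) <= - (l / H)).
    { intros z. apply Ropp_le_contravar. apply Rmult_le_compat_r. lra. apply Rmax_l. }
    eapply Rle_trans. apply exp_Lipschitz with (U := - (l / H)); apply hm.
    apply Rmult_le_compat_l. lra.
    replace (- (Rmax l x / H) - - (Rmax l x' / H)) with ((Rmax l x' - Rmax l x) * / H) by (unfold Rdiv; ring).
    rewrite Rabs_mult, (Rabs_pos_eq (/ H)) by lra.
    apply Rmult_le_compat_r. lra.
    unfold Rmax. repeat destruct Rle_dec; unfold Rabs; repeat destruct Rcase_abs; lra. }
  assert (hK := hk s). assert (hx0 := Rabs_pos (x - x')). assert (hq0 := Rabs_pos (q - q')).
  (* The difference of products is split into a change of the exponential, weighted by
     [c ^ 2 <= P ^ 2], and a change of the square, where [|c + c'| <= 2 P]. *)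
  replace (k s * (c ^ 2 * e) + beta s - (k s * (c' ^ 2 * e') + beta s))
    with (k s * (c ^ 2 * (e - e') + (c + c') * (c - c') * e')) by ring.
  rewrite Rabs_mult, (Rabs_pos_eq (k s)), !Rmult_assoc by lra.
  apply Rmult_le_compat; try lra. apply Rabs_pos.
  eapply Rle_trans. apply Rabs_triang. rewrite !Rabs_mult.
  rewrite (Rabs_pos_eq (c ^ 2)) by nra. rewrite (Rabs_pos_eq e') by lra.
  apply Rle_trans with (P ^ 2 * (E * (Rabs (x - x') / H)) + 2 * P * (Rabs (q - q') * E)).
  - apply Rplus_le_compat.
    + apply Rmult_le_compat; trivial. nra. apply Rabs_pos. nra.
    + apply Rmult_le_compat.
      apply Rabs_pos. apply Rmult_le_pos. apply Rabs_pos. lra.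
      apply Rabs_le. lra.
      apply Rmult_le_compat; try lra. apply Rabs_pos.
  - assert (hP2 : 0 <= P ^ 2 / H) by (apply Rmult_le_pos; nra).
    replace (P ^ 2 * (E * (Rabs (x - x') / H)) + 2 * P * (Rabs (q - q') * E))
      with (E * (P ^ 2 / H * Rabs (x - x') + 2 * P * Rabs (q - q'))) by (field; lra).
    apply Rmult_le_compat_l. lra. nra.
Qed.

(** * A priori bounds *)

Lemma mean_value (f df : R -> R) (s t : R) :
  s <= t -> (forall r, is_derive f r (df r)) ->
  exists r, s <= r <= t /\ f t - f s = df r * (t - s).
Proof.
  intros hst hf.
  destruct (MVT_gen f s t df) as [r [hr e]].
  - intros; apply hf.
  - intros r _. apply continuity_pt_filterlim. apply (ex_derive_continuous f). eexists; apply hf.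
  - exists r. rewrite Rmin_left, Rmax_right in hr by trivial. now split.
Qed.

Lemma increment_ge (f df : R -> R) (C s t : R) :
  s <= t -> (forall r, is_derive f r (df r)) ->
  (forall r, s <= r <= t -> C <= df r) -> C * (t - s) <= f t - f s.
Proof.
  intros hst hf hC. destruct (mean_value f df s t hst hf) as [r [hr ->]].
  apply Rmult_le_compat_r. lra. now apply hC.
Qed.

Lemma increment_le (f df : R -> R) (C s t : R) :
  s <= t -> (forall r, is_derive f r (df r)) ->
  (forall r, s <= r <= t -> df r <= C) -> f t - f s <= C * (t - s).
Proof.
  intros hst hf hC. destruct (mean_value f df s t hst hf) as [r [hr ->]].
  apply Rmult_le_compat_r. lra. now apply hC.
Qed.

(** As [p' = - h <= b0], the velocity is at least [- V] before [tau] and at most [V] after it, with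
    [V = |p tau| + b0 (t1 - t0)]. Integrate forward from [t0] in the first case, and backward from
    [t1] in the second. *)
Lemma lower_bound_of_concavity (x p h : R -> R) (t0 t1 b0 tau t : R) :
  (forall t, is_derive x t (p t)) -> (forall t, is_derive p t (- h t)) ->
  0 <= b0 -> (forall t, t0 <= t <= t1 -> - b0 <= h t) ->
  t0 <= tau <= t1 -> t0 <= t <= t1 ->
  Rmin (x t0) (x t1) - (Rabs (p tau) + b0 * (t1 - t0)) * (t1 - t0) <= x t.
Proof.
  intros hx hp hb hh htau ht.
  assert (hinc : forall s r, t0 <= s -> s <= r -> r <= t1 -> p r - p s <= b0 * (t1 - t0)).
  { intros s r h1 h2 h3. apply Rle_trans with (b0 * (r - s)).
    - apply increment_le with (fun t => - h t); trivial.
      intros q hq. generalize (hh q). lra.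
    - apply Rmult_le_compat_l; lra. }
  set (V := Rabs (p tau) + b0 * (t1 - t0)).
  assert (hV : 0 <= V).
  { generalize (Rabs_pos (p tau)). assert (0 <= b0 * (t1 - t0)) by (apply Rmult_le_pos; lra).
    unfold V; lra. }
  destruct (Rle_dec t tau) as [hle|hle].
  - assert (h1 : - V * (t - t0) <= x t - x t0).
    { apply increment_ge with p; trivial. lra. intros r hr.
      generalize (hinc r tau) (Rle_abs (- p tau)). rewrite Rabs_Ropp. unfold V. lra. }
    generalize (Rmin_l (x t0) (x t1)). nra.
  - assert (h1 : x t1 - x t <= V * (t1 - t)).
    { apply increment_le with p; trivial. lra. intros r hr.
      generalize (hinc tau r) (Rle_abs (p tau)). unfold V. lra. }
    generalize (Rmin_r (x t0) (x t1)). nra.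
Qed.

(* The weight solves [drag_weight' x = K * exp (- x / H) * drag_weight x], so
   the derivative of [p * drag_weight x] absorbs the quadratic term. *)
Definition drag_weight (K H x : R) : R := exp (- (K * H * exp (- (x / H)))).

Lemma drag_weight_le_1 K H x : 0 <= K -> 0 < H -> 0 < drag_weight K H x <= 1.
Proof.
  intros hK hH. split. apply exp_pos.
  rewrite <- exp_0. apply exp_le_compat.
  generalize (exp_pos (- (x / H))). intros.
  assert (0 <= K * H * exp (- (x / H))) by (repeat apply Rmult_le_pos; lra). lra.
Qed.

Lemma drag_weight_monotone K H x x' :
  0 <= K -> 0 < H -> x <= x' -> drag_weight K H x <= drag_weight K H x'.
Proof.
  intros hK hH hx. apply exp_le_compat, Ropp_le_contravar.
  apply Rmult_le_compat_l. apply Rmult_le_pos; lra.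
  apply exp_le_compat, Ropp_le_contravar.
  apply Rmult_le_compat_r; trivial. left; now apply Rinv_0_lt_compat.
Qed.

(** Two one-sided estimates are combined: [p] increases by at most [b0 (t1 - t0)], and [p * W x]
    decreases by at most as much. Before [tau] they bound [p] from below and above respectively;
    after [tau] the roles are exchanged. *)
Lemma velocity_bound (x p h : R -> R) (t0 t1 b0 K H l tau t : R) :
  0 < H -> 0 <= K -> 0 <= b0 ->
  (forall t, is_derive x t (p t)) -> (forall t, is_derive p t (- h t)) ->
  (forall t, t0 <= t <= t1 -> - b0 <= h t <= K * (p t ^ 2 * exp (- (x t / H))) + b0) ->
  (forall t, t0 <= t <= t1 -> l <= x t) ->
  t0 <= tau <= t1 -> t0 <= t <= t1 ->
  Rabs (p t) <= (Rabs (p tau) + b0 * (t1 - t0)) / drag_weight K H l.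
Proof.
  intros hH hK hb hx hp hh hl htau ht.
  set (V := Rabs (p tau) + b0 * (t1 - t0)). set (W := drag_weight K H).
  assert (hW : forall z, 0 < W z <= 1) by (intros; now apply drag_weight_le_1).
  assert (hinc : forall s r, t0 <= s -> s <= r -> r <= t1 -> p r - p s <= b0 * (t1 - t0)).
  { intros s r h1 h2 h3. apply Rle_trans with (b0 * (r - s)).
    - apply increment_le with (fun t => - h t); trivial.
      intros q hq. generalize (hh q). lra.
    - apply Rmult_le_compat_l; lra. }
  assert (hdec : forall s r, t0 <= s -> s <= r -> r <= t1 ->
    - (b0 * (t1 - t0)) <= p r * W (x r) - p s * W (x s)).
  { intros s r h1 h2 h3. apply Rle_trans with (- b0 * (r - s)).
    { assert (b0 * (r - s) <= b0 * (t1 - t0)) by (apply Rmult_le_compat_l; lra). lra. }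
    apply (increment_ge (fun t => p t * W (x t))
      (fun t => W (x t) * (K * (p t ^ 2 * exp (- (x t / H))) - h t))); trivial.
    - intros q.
      assert (hWd : forall z, is_derive W z (W z * (K * exp (- (z / H))))).
      { intros z. unfold W, drag_weight. auto_derive. trivial. unfold Rdiv. field. lra. }
      replace (W (x q) * (K * (p q ^ 2 * exp (- (x q / H))) - h q))
        with (plus (mult (- h q) (W (x q))) (mult (p q) (scal (p q) (W (x q) * (K * exp (- (x q / H)))))))
        by (unfold plus, mult, scal; simpl; unfold mult; simpl; ring).
      apply (is_derive_mult p (fun t => W (x t))).
      + apply hp.
      + apply (is_derive_comp W x). apply hWd. apply hx.
      + intros; apply Rmult_comm.
    (* The bracket is at least [- b0] and is multiplied by a weight in [(0, 1]], so the product is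
       again at least [- b0]. *)
    - intros q hq. generalize (hh q) (hW (x q)). intros h4 h5.
      assert (h6 : - b0 <= K * (p q ^ 2 * exp (- (x q / H))) - h q) by lra.
      nra. }
  assert (h0 := Rabs_pos (p tau)).
  assert (hbT : 0 <= b0 * (t1 - t0)) by (apply Rmult_le_pos; lra).
  assert (hWl : W l <= W (x t)) by (apply drag_weight_monotone; auto).
  assert (hl0 := hW l). assert (hxt := hW (x t)). assert (hxtau := hW (x tau)).
  assert (hpw : Rabs (p tau * W (x tau)) <= Rabs (p tau)).
  { rewrite Rabs_mult, (Rabs_pos_eq (W _)) by lra. nra. }
  apply Rabs_le_between in hpw.
  assert (hVW : V <= V / W l).
  { apply Rle_div_r. lra. unfold V. nra. }
  generalize (Rle_abs (p tau)) (Rle_abs (- p tau)). rewrite Rabs_Ropp. intros ha1 ha2.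
  (* For [q >= 0] the weight at [x t] may be lowered to [W l]; for [q < 0] the bound is clear, as
     [V >= 0]. *)
  assert (hbig : forall q, q * W (x t) <= V -> q <= V / W l).
  { intros q hq. apply Rle_div_r. lra. destruct (Rle_dec 0 q). nra.
    unfold V in *. nra. }
  destruct (Rle_dec t tau) as [hle|hle].
  - generalize (hinc t tau) (hdec t tau). intros h1 h2.
    apply Rabs_le. split. unfold V in *; lra. apply hbig. unfold V; lra.
  - generalize (hinc tau t) (hdec tau t). intros h1 h2.
    apply Rabs_le. split; [|unfold V in *; lra].
    cut (- p t <= V / W l). lra. apply hbig. unfold V; lra.
Qed.

(** * Solving the problem in the coordinate [x] by removing the truncation *)

Lemma drag_bvp (k beta : R -> R) (H t0 t1 x0 x1 K b0 : R) :
  t0 < t1 -> 0 < H ->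
  (forall t, continuous k t) -> (forall t, continuous beta t) ->
  (forall t, 0 <= k t <= K) -> (forall t, Rabs (beta t) <= b0) ->
  exists x p h : R -> R,
    (forall t, is_derive x t (p t)) /\ (forall t, is_derive p t (- h t)) /\
    (forall t, continuous h t) /\
    (forall t, t0 <= t <= t1 -> h t = k t * (p t ^ 2 * exp (- (x t / H))) + beta t) /\
    x t0 = x0 /\ x t1 = x1.
Proof.
  intros ht hH ck cb hk hb.
  assert (hK : 0 <= K) by (generalize (hk 0); lra).
  assert (hb0 : 0 <= b0) by (eapply Rle_trans; [apply Rabs_pos | apply (hb 0)]).
  (* The constants are chosen in the order [a], [V], [l], [P], each from the data and the earlier
     ones. Thus [l] and [P] are fixed before the truncated problem is solved. *)
  set (a := (x1 - x0) / (t1 - t0)).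
  set (V := Rabs a + b0 * (t1 - t0)).
  set (l := Rmin x0 x1 - V * (t1 - t0)).
  set (P := V / drag_weight K H l).
  assert (hV : 0 <= V).
  { generalize (Rabs_pos a). assert (0 <= b0 * (t1 - t0)) by (apply Rmult_le_pos; lra). unfold V; lra. }
  assert (hP : 0 <= P).
  { apply Rmult_le_pos; trivial. left. apply Rinv_0_lt_compat. now apply drag_weight_le_1. }
  destruct (shooting (truncated_force k beta H l P) t0 t1 x0 x1
    (K * (exp (- (l / H)) * (P ^ 2 / H + 2 * P))) (K * (P ^ 2 * exp (- (l / H))) + b0))
    as (x & p & h & hx & hp & ch & hh & hx0 & hx1); trivial.
  - now apply truncated_force_substitutive.
  - apply Rmult_le_pos; trivial. apply Rmult_le_pos. left; apply exp_pos.
    apply Rplus_le_le_0_compat; [|lra].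
    apply Rmult_le_pos. nra. left; now apply Rinv_0_lt_compat.
  - now apply truncated_force_Lipschitz.
  - intros. now apply truncated_force_bound.
  - assert (hE : forall z, 0 < exp (- (z / H))) by (intros; apply exp_pos).
    assert (hlow : forall t, t0 <= t <= t1 -> - b0 <= h t).
    { intros t hs. rewrite hh by lra. unfold truncated_force.
      generalize (hb t). intros hbt. apply Rabs_le_between in hbt.
      assert (0 <= k t * (clamp (- P) P (p t) ^ 2 * exp (- (Rmax l (x t) / H)))).
      { apply Rmult_le_pos. apply hk. apply Rmult_le_pos. now apply clamp_sqr_le. left; apply hE. }
      lra. }
    (* By the mean value theorem the velocity equals the mean slope [a] at some [tau]; both a priori
       bounds start from there. *)
    assert (htau : exists tau, t0 <= tau <= t1 /\ p tau = a).
    { destruct (mean_value x p t0 t1) as [tau [h1 h2]]; trivial. lra.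
      exists tau. split; trivial. unfold a. rewrite <- hx0, <- hx1, h2. field. lra. }
    destruct htau as [tau [htau hpt]].
    assert (hl : forall t, t0 <= t <= t1 -> l <= x t).
    { intros t hs. unfold l, V. rewrite <- hpt, <- hx0, <- hx1.
      apply lower_bound_of_concavity with h; trivial. }
    assert (hpP : forall t, t0 <= t <= t1 -> Rabs (p t) <= P).
    { intros t hs. unfold P, V. rewrite <- hpt.
      apply velocity_bound with x h; trivial.
      intros s hs'. split. now apply hlow.
      rewrite hh by lra. unfold truncated_force. rewrite (Rmax_right l) by now apply hl.
      generalize (hb s) (hk s). intros hbs hks. apply Rabs_le_between in hbs.
      apply Rplus_le_compat; [|lra].
      (* Clamping to an interval around 0 does not increase the modulus, so the truncated drag is
         dominated by the true one and [velocity_bound] applies before [|p| <= P] is known. *)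
      assert (hsq : clamp (- P) P (p s) ^ 2 <= p s ^ 2).
      { rewrite <- !Rsqr_pow2. apply Rsqr_le_abs_1. generalize (clamp_Lipschitz (- P) P (p s) 0).
        rewrite (clamp_id (- P) P 0) by lra. now rewrite !Rminus_0_r. }
      apply Rmult_le_compat; try lra.
      - apply Rmult_le_pos. now apply clamp_sqr_le. left; apply hE.
      - apply Rmult_le_compat_r; trivial. left; apply hE. }
    exists x, p, h. repeat (split; trivial).
    intros t hs. rewrite hh by lra. unfold truncated_force.
    rewrite (Rmax_right l) by now apply hl. rewrite clamp_id. reflexivity.
    apply Rabs_le_between. now apply hpP.
Qed.

(** * Representation by the Green function *)

Lemma green_left t0 t1 t s : s < t -> green t0 t1 t s = (s - t0) * (t1 - t) / (t1 - t0).
Proof. intros. unfold green. destruct Rle_dec; lra. Qed.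

Lemma green_right t0 t1 t s : t < s -> green t0 t1 t s = (t - t0) * (t1 - s) / (t1 - t0).
Proof. intros. unfold green. destruct Rle_dec; lra. Qed.

(** On an interval on one side of [t], the kernel agrees in the interior with a function affine in
    [s]. *)
Lemma ex_RInt_green t0 t1 t u a b :
  a <= b -> (b <= t \/ t <= a) -> (forall s, continuous u s) ->
  ex_RInt (fun s => green t0 t1 t s * u s) a b.
Proof.
  intros hab hd hu. destruct hd as [hd|hd].
  - apply (ex_RInt_ext (fun s => (s - t0) * (t1 - t) / (t1 - t0) * u s)).
    + intros s hs. rewrite Rmax_right in hs by lra. rewrite green_left; trivial. lra.
    + apply ex_RInt_continuous_all. intros s.
      apply (continuous_mult (fun s => (s - t0) * (t1 - t) / (t1 - t0))); trivial.
      apply (ex_derive_continuous (fun s => (s - t0) * (t1 - t) / (t1 - t0))). auto_derive. trivial.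
  - apply (ex_RInt_ext (fun s => (t - t0) * (t1 - s) / (t1 - t0) * u s)).
    + intros s hs. rewrite Rmin_left in hs by lra. rewrite green_right; trivial. lra.
    + apply ex_RInt_continuous_all. intros s.
      apply (continuous_mult (fun s => (t - t0) * (t1 - s) / (t1 - t0))); trivial.
      apply (ex_derive_continuous (fun s => (t - t0) * (t1 - s) / (t1 - t0))). auto_derive. trivial.
Qed.

(** On each side of [t] the integrand has an explicit primitive, found by integrating by parts. *)
Lemma green_representation (w dw h : R -> R) (t0 t1 t : R) :
  t0 < t1 -> (forall t, is_derive w t (dw t)) -> (forall t, is_derive dw t (- h t)) ->
  (forall t, continuous h t) -> w t0 = 0 -> w t1 = 0 -> t0 <= t <= t1 ->
  w t = RInt (fun s => green t0 t1 t s * h s) t0 t1.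
Proof.
  intros ht hw hdw ch hw0 hw1 hI. symmetry. apply is_RInt_unique.
  assert (hDw : forall s, Derive (fun x : R => w x) s = dw s)
    by (intros s; apply is_derive_unique, hw).
  assert (hDdw : forall s, Derive (fun x : R => dw x) s = - h s)
    by (intros s; apply is_derive_unique, hdw).
  assert (hd : forall f df a b, (forall s, is_derive f s (df s)) -> (forall s, continuous df s) ->
    is_RInt df a b (f b - f a)).
  { intros f df a b hf hc. apply (is_RInt_derive f df); intros; trivial. }
  (* These are the increments of the two primitives over [[t0, t]] and [[t, t1]]. The terms in
     [dw t] cancel, and the coefficients of [w t] add up to 1. *)
  replace (w t) with (plus
    ((t1 - t) / (t1 - t0) * (w t - (t - t0) * dw t) - (t1 - t) / (t1 - t0) * (w t0 - (t0 - t0) * dw t0))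
    ((t - t0) / (t1 - t0) * (- w t1 - (t1 - t1) * dw t1) - (t - t0) / (t1 - t0) * (- w t - (t1 - t) * dw t)))
    by (rewrite hw0, hw1; unfold plus; simpl; field; lra).
  apply (is_RInt_Chasles (V := R_NormedModule) _ t0 t t1).
  - apply (is_RInt_ext (fun s => (s - t0) * (t1 - t) / (t1 - t0) * h s)).
    + intros s hs. rewrite Rmax_right in hs by lra. rewrite green_left; trivial. lra.
    + apply (hd (fun s => (t1 - t) / (t1 - t0) * (w s - (s - t0) * dw s))).
      * intros s. auto_derive.
        -- split; [|split]; trivial; eexists; [apply hw | apply hdw].
        -- rewrite hDw, hDdw. field. lra.
      * intros s. apply (continuous_mult (fun s => (s - t0) * (t1 - t) / (t1 - t0))); trivial.
        apply (ex_derive_continuous (fun s => (s - t0) * (t1 - t) / (t1 - t0))). auto_derive. trivial.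
  - apply (is_RInt_ext (fun s => (t - t0) * (t1 - s) / (t1 - t0) * h s)).
    + intros s hs. rewrite Rmin_left in hs by lra. rewrite green_right; trivial. lra.
    + apply (hd (fun s => (t - t0) / (t1 - t0) * (- w s - (t1 - s) * dw s))).
      * intros s. auto_derive.
        -- split; [|split]; trivial; eexists; [apply hw | apply hdw].
        -- rewrite hDw, hDdw. field. lra.
      * intros s. apply (continuous_mult (fun s => (t - t0) * (t1 - s) / (t1 - t0))); trivial.
        apply (ex_derive_continuous (fun s => (t - t0) * (t1 - s) / (t1 - t0))). auto_derive. trivial.
Qed.

(** * Passing between [[t0, t1]] and R *)

(** The retraction is continuous with values in [[t0, t1]], so it maps the neighbourhood filter of
    [t] into the filter within that interval. *)
Lemma continuous_on_clamp t0 t1 (u : R -> R) t :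
  t0 <= t1 -> continuous_on (Icc t0 t1) u -> continuous (fun t => u (clamp t0 t1 t)) t.
Proof.
  intros ht hu.
  apply (filterlim_comp _ _ _ (clamp t0 t1) u _ (within (Icc t0 t1) (locally (clamp t0 t1 t)))).
  - intros Q hQ. generalize (continuous_clamp t0 t1 t _ hQ). unfold filtermap.
    apply filter_imp. intros s hs. apply hs. now apply clamp_between.
  - apply hu. now apply clamp_between.
Qed.

Lemma D_in_continuous_on D (f df : R -> R) :
  (forall t, D t -> D_in f df D t) -> continuous_on D f.
Proof.
  intros hf t ht. apply filterlim_locally. intros eps.
  destruct (cont_deriv _ _ _ _ (hf t ht) eps (cond_pos eps)) as [d [hd h]].
  exists (mkposreal d hd). intros s hs hDs.
  (* The limit in [D_in] excludes the base point, which is treated apart. *)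
  destruct (Req_dec s t) as [->|hne]. apply ball_center.
  apply (h s). split. split; trivial. now apply not_eq_sym. exact hs.
Qed.

Lemma is_derive_D_in D (f df : R -> R) t : is_derive f t (df t) -> D_in f df D t.
Proof.
  intros hf%is_derive_Reals.
  unfold D_in, limit1_in, limit_in; simpl. intros eps heps.
  destruct (hf eps heps) as [d hd]. exists d. split. apply cond_pos.
  intros s [[_ hne] hs]. unfold Rdist in *.
  generalize (hd (s - t)). replace (t + (s - t)) with s by ring.
  intros hh. apply hh; trivial. lra.
Qed.

Lemma continuous_clamp_bounded t0 t1 (u : R -> R) :
  t0 <= t1 -> (forall t, continuous (fun t => u (clamp t0 t1 t)) t) ->
  exists C, forall t, Rabs (u (clamp t0 t1 t)) <= C.
Proof.
  intros ht hu.
  destruct (continuity_ab_maj (fun t => Rabs (u (clamp t0 t1 t))) t0 t1 ht) as [r [hr _]].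
  - intros s _. apply continuity_pt_filterlim.
    apply (continuous_comp (fun t => u (clamp t0 t1 t)) Rabs). apply hu. apply continuous_Rabs.
  - exists (Rabs (u (clamp t0 t1 r))). intros t.
    assert (h := clamp_between t0 t1 t ht).
    generalize (hr _ h). now rewrite (clamp_id t0 t1 (clamp t0 t1 t)).
Qed.

Theorem theorem1 (t0 t1 x0 x1 H g A CD rho0 : R) (m dm c : R -> R)
  (ht : t0 < t1) (hH : 0 < H) (hg : 0 < g)
  (hA : 0 <= A) (hCD : 0 <= CD) (hrho0 : 0 <= rho0)
  (hm_pos : forall t, Icc t0 t1 t -> 0 < m t)
  (hm_C1 : C1_on t0 t1 m dm)
  (hc : continuous_on (Icc t0 t1) c) :
  let a := (x1 - x0) / (t1 - t0) in
  let y := fun t => a * (t - t0) + x0 in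
  let alpha := fun t => A * CD * rho0 / (2 * m t) * exp (- (y t / H)) in
  let beta := fun t => g - c t * (dm t / m t) in
  let B := Bconst t0 t1 beta in
  let G2 := supnorm t0 t1 alpha * (t1 - t0) ^ 2 in
  4 * (a + B) * G2 < 1 ->
  exists z : R -> R, bvp_solution t0 t1 H a alpha beta z.
Proof.
  intros a y alpha beta B G2 _.
  (* This is [alpha] without [exp (- y / H)], a factor that joins [exp (- z / H)] to form
     [exp (- x / H)]. *)
  set (k := fun t => A * CD * rho0 / (2 * m t)).
  set (cl := clamp t0 t1).
  assert (hcl : forall t, Icc t0 t1 (cl t)) by (intros t; apply clamp_between; lra).
  assert (hid : forall t, Icc t0 t1 t -> cl t = t) by (intros t; apply clamp_id).
  assert (hm : forall t, 0 < m (cl t)) by auto.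
  assert (cinv : forall t, continuous (fun t => / m (cl t)) t).
  { intros t. apply (continuous_comp (fun t => m (cl t)) Rinv).
    - apply continuous_on_clamp. lra. apply D_in_continuous_on with dm. apply hm_C1.
    - apply continuity_pt_filterlim. apply (continuity_pt_inv id).
      apply continuity_pt_id. unfold id. specialize (hm t). lra. }
  assert (ck : forall t, continuous (fun t => k (cl t)) t).
  { intros t. apply (continuous_ext (fun t => A * CD * rho0 / 2 * / m (cl t))).
    - intros s. assert (hs := hm s).
      assert (e : A * CD * rho0 / 2 * / m (cl s) = k (cl s)) by (unfold k; field; lra).
      exact e.
    - apply (continuous_mult (fun _ => A * CD * rho0 / 2)); trivial. apply continuous_const. }
  assert (cb : forall t, continuous (fun t => beta (cl t)) t).
  { intros t. apply (continuous_minus (fun _ => g) (fun t => c (cl t) * (dm (cl t) / m (cl t)))).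
    - apply continuous_const.
    - apply (continuous_mult (fun t => c (cl t))).
      + apply continuous_on_clamp; trivial. lra.
      + apply (continuous_mult (fun t => dm (cl t))); trivial.
        apply continuous_on_clamp. lra. apply hm_C1. }
  destruct (continuous_clamp_bounded t0 t1 k) as [K hK]; [lra | exact ck |].
  destruct (continuous_clamp_bounded t0 t1 beta) as [b0 hb]; [lra | exact cb |].
  assert (hk : forall t, 0 <= k (cl t) <= K).
  { intros t. split.
    - apply Rmult_le_pos. repeat apply Rmult_le_pos; trivial.
      left. apply Rinv_0_lt_compat. specialize (hm t). lra.
    - eapply Rle_trans. apply Rle_abs. apply hK. }
  destruct (drag_bvp (fun t => k (cl t)) (fun t => beta (cl t)) H t0 t1 x0 x1 K b0 ht hH ck cb hk hb)
    as (x & p & h & hx & hp & ch & hh & hx0 & hx1).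
  (* Subtracting the affine [y] makes the boundary values zero and leaves the second derivative
     [- h] unchanged. *)
  set (z := fun t => x t - y t). set (dz := fun t => p t - a).
  assert (hz : forall t, is_derive z t (dz t)).
  { intros t. apply (is_derive_minus x y). apply hx.
    unfold y. auto_derive. trivial. ring. }
  assert (hdz : forall t, is_derive dz t (- h t)).
  { intros t. assert (hd := is_derive_minus p (fun _ => a) t (- h t) zero (hp t) (is_derive_const a t)).
    unfold minus, opp, plus, zero in hd; simpl in hd. rewrite Ropp_0, Rplus_0_r in hd. exact hd. }
  exists z, dz. split.
  - split.
    + intros t _. now apply is_derive_D_in.
    + intros t _. intros Q hQ. apply filter_le_within.
      apply (ex_derive_continuous dz t); trivial. eexists; apply hdz.
  - intros t hI.
    rewrite (green_representation z dz h t0 t1 t); trivial.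
    2: { unfold z, y. rewrite hx0. ring. }
    2: { unfold z, y, a. rewrite hx1. field. lra. }
    assert (hex : forall u, (forall s, continuous u s) ->
      ex_RInt (fun s => green t0 t1 t s * u s) t0 t1).
    { intros u hu. destruct hI. apply (ex_RInt_Chasles _ t0 t t1); apply ex_RInt_green; auto; lra. }
    assert (c1 : forall s, continuous (fun s => h s - beta (cl s)) s)
      by (intros s; now apply (continuous_minus h (fun s => beta (cl s)))).
    (* Splitting [h] into its drag part and [beta] yields the nonlinear integral and [bfun]; on
       [[t0, t1]] the extended data are the original ones. *)
    transitivity (RInt (fun s => plus (green t0 t1 t s * (h s - beta (cl s)))
                                      (green t0 t1 t s * beta (cl s))) t0 t1).
    { apply RInt_ext. intros s _. unfold plus; simpl; ring. }
    rewrite (RInt_plus (fun s => green t0 t1 t s * (h s - beta (cl s)))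
                       (fun s => green t0 t1 t s * beta (cl s))) by auto.
    unfold plus; simpl. f_equal; apply RInt_ext; intros s hs;
      rewrite Rmin_left, Rmax_right in hs by lra;
      assert (hIs : Icc t0 t1 s) by (split; lra).
    + rewrite hh by exact hIs. rewrite (hid s hIs). f_equal.
      unfold alpha, dz, z.
      replace (p s - a + a) with (p s) by ring.
      replace (exp (- (x s / H))) with (exp (- (y s / H)) * exp (- ((x s - y s) / H))).
      2: { rewrite <- exp_plus. f_equal. field. lra. }
      unfold k. ring.
    + now rewrite (hid s hIs).
Qed.
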